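(* Let $n\ge 1$ be an integer, let $f\in C^1(\mathbb{T},(0,\infty))$ and $g\in C^2(\mathbb{T},(0,\infty))$. For each $\varepsilon>0$ let $u^\varepsilon$ be the solution, with quenching time $T^\ast_\varepsilon\in(0,\infty]$, of $$u^\varepsilon_t=\frac{u^\varepsilon_{xx}}{(u^\varepsilon_x)^2+1}-\frac{n-1}{u^\varepsilon}+\frac1\varepsilon f(x)\sqrt{(u^\varepsilon_x)^2+1}\quad\text{for } x\in\mathbb{T},\ t\in(0,T^\ast_\varepsilon),\qquad u^\varepsilon(x,0)=\varepsilon\, g(x)\quad\text{for } x\in\mathbb{T}.$$ (a) If $\min_{x\in\mathbb{T}}f(x)g(x)>n-1$, then there exist $\varepsilon_0>0$ and $c_0>0$ such that for every $\varepsilon\in(0,\varepsilon_0)$ one has $T^\ast_\varepsilon=\infty$ and $$u^\varepsilon(x,t)\ge \varepsilon c_0\quad\text{for all } x\in\mathbb{T},\ t\in[0,\infty).$$ (b) If $\max_{x\in\mathbb{T}}f(x)\,\max_{x\in\mathbb{T}}g(x)<n-1$, then $T^\ast_\varepsilon<\infty$ for all $\varepsilon>0$.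
   Context: $\mathbb{T}=\mathbb{R}/\mathbb{Z}$ is the one-dimensional flat torus; functions on $\mathbb{T}$ are identified with $\mathbb{Z}$-periodic functions on $\mathbb{R}$. The solution $u^\varepsilon$ is the unique positive classical solution, which exists as long as its infimum over $\mathbb{T}$ stays positive. The quenching time is $T^\ast_\varepsilon:=\sup\{t>0\mid \inf_{x\in\mathbb{T}}u^\varepsilon(x,t)>0\}\in(0,\infty]$. Quenching occurs if $T^\ast_\varepsilon<\infty$ (so that the solution reaches the value $0$ at time $T^\ast_\varepsilon$, i.e. $\inf_{\mathbb{T}\times[0,T^\ast_\varepsilon)}u^\varepsilon=0$), and does not occur if $T^\ast_\varepsilon=\infty$. *)

(* Defs.v *)
From HB Require Import structures.
From mathcomp Require Import all_boot all_order all_algebra.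
From mathcomp Require Import all_classical all_reals all_analysis.

Set Implicit Arguments.
Unset Strict Implicit.
Unset Printing Implicit Defensive.

Import Order.TTheory GRing.Theory Num.Theory.
Import numFieldNormedType.Exports.

Local Open Scope classical_set_scope.
Local Open Scope ring_scope.

(* Functions on the torus R/Z are 1-periodic functions on R; consequently the
   range of a torus function is its range over R, and for a continuous torus
   function [inf (range h)] and [sup (range h)] are its minimum and maximum. *)

Definition torus_Ck (R : realType) (k : nat) (h : R -> R) : Prop :=
  [/\ periodic h 1,
      forall i, (i < k)%N -> forall x, derivable (derive1n i h) x 1
    & continuous (derive1n k h)].

Definition torus_min (R : realType) (h : R -> R) : R := inf (range h).
Definition torus_max (R : realType) (h : R -> R) : R := sup (range h).

(* In [u x t] the first argument is the space variable. *)
Definition dt (R : realType) (u : R -> R -> R) (x t : R) : R := derive1 (u x) t.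
Definition dx (R : realType) (u : R -> R -> R) (x t : R) : R :=
  derive1 (u ^~ t) x.
Definition dxx (R : realType) (u : R -> R -> R) (x t : R) : R :=
  derive1n 2 (u ^~ t) x.

Definition closed_time (R : realType) (S : \bar R) : set R :=
  [set t | 0 <= t /\ (t%:E < S)%E].
Definition open_time (R : realType) (S : \bar R) : set R :=
  [set t | 0 < t /\ (t%:E < S)%E].

(* Positive classical solutions on [0, S): continuous up to t = 0, and of class
   C^{2,1} for 0 < t < S. Values of [u] at times outside [0, S) are junk. *)
Record classical_solution (R : realType) (n : nat) (f g : R -> R) (eps : R)
    (S : \bar R) (u : R -> R -> R) : Prop := ClassicalSolution {
  sol_periodic : forall t, closed_time S t -> periodic (u ^~ t) 1;
  sol_continuous :
    {within [set p : R * R | closed_time S p.2],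
      continuous (fun p : R * R => u p.1 p.2)};
  sol_derivable_t :
    forall x t, open_time S t -> derivable (u x) t 1;
  sol_derivable_x :
    forall x t, open_time S t -> derivable (u ^~ t) x 1;
  sol_derivable_xx :
    forall x t, open_time S t -> derivable (derive1 (u ^~ t)) x 1;
  sol_continuous_t :
    {within [set p : R * R | open_time S p.2],
      continuous (fun p : R * R => dt u p.1 p.2)};
  sol_continuous_x :
    {within [set p : R * R | open_time S p.2],
      continuous (fun p : R * R => dx u p.1 p.2)};
  sol_continuous_xx :
    {within [set p : R * R | open_time S p.2],
      continuous (fun p : R * R => dxx u p.1 p.2)};
  sol_positive : forall x t, closed_time S t -> 0 < u x t;
  sol_equation : forall x t, open_time S t ->
    dt u x t = dxx u x t / (dx u x t ^+ 2 + 1)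
               - (n%:R - 1) / u x t
               + eps^-1 * f x * Num.sqrt (dx u x t ^+ 2 + 1);
  sol_initial : forall x, u x 0 = eps * g x
}.

(* The solution with its lifetime [S]: it exists as long as its infimum stays
   positive, so that it can only stop at a finite time by reaching 0. *)
Definition maximal_solution (R : realType) (n : nat) (f g : R -> R) (eps : R)
    (S : \bar R) (u : R -> R -> R) : Prop :=
  [/\ (0 < S)%E,
      classical_solution n f g eps S u
    & (S < +oo)%E ->
      inf [set y | exists x t, closed_time S t /\ y = u x t] = 0].

Definition quenching_time (R : realType) (S : \bar R) (u : R -> R -> R)
    : \bar R :=
  ereal_sup [set t%:E | t in
    [set t | open_time S t /\ 0 < inf (range (u ^~ t))]].

(* Main.v *)
Require Import Defs.
From HB Require Import structures.
From mathcomp Require Import all_boot all_order all_algebra.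
From mathcomp Require Import all_classical all_reals all_analysis.
From mathcomp Require Import ring lra.

Set Implicit Arguments.
Unset Strict Implicit.
Unset Printing Implicit Defensive.

Import Order.TTheory GRing.Theory Num.Theory.
Import numFieldNormedType.Exports.

Local Open Scope classical_set_scope.
Local Open Scope ring_scope.

(* Both parts compare the solution with a strict barrier at the first time they
   touch; there the space derivatives are ordered and the equation contradicts
   the sign of the time derivative.
   (a) For small eps the rescaled datum eps g is itself a stationary
   subsolution: the diffusion term is O(eps), whereas the reaction terms equal
   (f g - (n - 1)) / (eps g).  Using lam * eps * g with lam < 1 close to 1 makes
   the comparison strict, and a solution bounded away from 0 is global.
   (b) If max f < (n - 1) / H for some H > max g, the spatially constant function
   eps H - c t is a supersolution for a suitable c > 0; it reaches 0 in finite
   time. *)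

(** * Periodic functions and their extrema *)

Lemma periodic_unit_repr (R : realType) (h : R -> R) (x : R) :
  periodic h 1 -> exists2 y, y \in `[0, 1] & h x = h y.
Proof.
move=> hp.
exists (x - (Num.floor x)%:~R).
  by rewrite in_itv /= subr_ge0 floor_le lerBlDr (le_trans (ltW (floorD1_gt x)))// intrD addrC.
(* [periodicn] shifts by natural multiples of the period: a nonnegative floor is added back to the
   representative, a negative one is already a shift forward from [x]. *)
case: (Num.floor x) => m.
  by rewrite -[in LHS](subrK (m%:R) x) (periodicn hp).
by rewrite NegzE mulrNz opprK -[RHS]/(h (x + _)) (periodicn hp).
Qed.

(** The supremum is an upper bound only once the range is bounded; periodicity reduces this to the
    extreme value theorem on [[0, 1]]. *)
Lemma periodic_le_torus_max (R : realType) (h : R -> R) :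
  periodic h 1 -> continuous h -> forall x, h x <= torus_max h.
Proof.
move=> hp hc x; apply: sup_upper_bound; last by exists x.
split; first by exists (h x), x.
have [c _ cP] := EVT_max (@ler01 R) (continuous_subspaceT hc).
exists (h c) => _ [y _ <-].
by have [z z01 ->] := periodic_unit_repr y hp; exact: cP.
Qed.

Lemma periodic_pos_lb (R : realType) (h : R -> R) :
  periodic h 1 -> continuous h -> (forall x, 0 < h x) ->
  exists2 c, 0 < c & forall x, c <= h x.
Proof.
move=> hp hc h0; have [c _ cP] := EVT_min (@ler01 R) (continuous_subspaceT hc).
exists (h c) => // x.
by have [z z01 ->] := periodic_unit_repr x hp; exact: cP.
Qed.

Lemma torus_min_le (R : realType) (h : R -> R) :
  (forall x, 0 < h x) -> forall x, torus_min h <= h x.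
Proof.
move=> h0 x; apply: ge_inf; last by exists x.
by exists 0 => _ [y _ <-]; exact/ltW.
Qed.

(** * Derivative tests at a minimum *)

(** At a first touching time only earlier times are controlled, so the sign is read off the left
    difference quotients. *)
Lemma derive1_left_min (R : realType) (h : R -> R) (a b : R) :
  derivable h a 1 -> b < a -> (forall s, b < s < a -> h a <= h s) ->
  derive1 h a <= 0.
Proof.
move=> hd ba hmin.
have hc : (fun k => k^-1 *: (h (k + a) - h a)) @ 0^' --> derive1 h a.
  by have := derivableP hd => -[+ _]; rewrite /derive1 /derivable;
    under eq_fun do rewrite /= scaler1.
have hl := cvg_dnbhs_at_left hc.
rewrite -(cvg_lim _ hl)//; apply: limr_le; first by apply/cvg_ex; eexists; exact: hl.
near=> k.
have k0 : k < 0 by near: k; exact: nbhs_left_lt.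
have kb : b - a < k by near: k; apply: nbhs_left_gt; lra.
apply: mulr_le0_ge0; first by rewrite invr_le0 ltW.
by rewrite subr_ge0 hmin//; lra.
Unshelve. all: by end_near. Qed.

Lemma derive1_global_min (R : realType) (h : R -> R) (a : R) :
  (forall x, derivable h x 1) -> (forall x, h a <= h x) -> derive1 h a = 0.
Proof.
move=> hd hmin; rewrite derive1E.
have H : is_derive a 1 h 0.
  by apply: (@derive1_at_min _ h (a - 1) (a + 1)) => //; rewrite ?in_itv/=; lra.
exact: derive_val.
Qed.

(** Since [h' a = 0], a negative second derivative would make [h'] negative just to the right of
    [a], and [h] would drop below its minimum there. *)
Lemma derive1_second_min (R : realType) (h : R -> R) (a : R) :
  (forall x, derivable h x 1) -> derivable (derive1 h) a 1 ->
  (forall x, h a <= h x) -> 0 <= derive1 (derive1 h) a.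
Proof.
move=> hd hdd hmin; have h0 := derive1_global_min hd hmin.
rewrite leNgt; apply/negP => neg.
have hc : (fun k => k^-1 *: (derive1 h (k + a) - derive1 h a)) @ 0^'
    --> derive1 (derive1 h) a.
  have := derivableP hdd => -[+ _]; rewrite {3}/derive1 /derivable.
  by under eq_fun do rewrite /= scaler1.
have : \forall k \near (0 : R)^'+, derive1 h (k + a) < 0.
  near=> k.
  have k0 : 0 < k by near: k; exact: nbhs_right_gt.
  have : k^-1 *: (derive1 h (k + a) - derive1 h a) < 0.
    by near: k; exact: (cvgr_lt _ (cvg_dnbhs_at_right hc)).
  by rewrite h0 subr0 -[_ *: _]/(_ * _) pmulr_rlt0 ?invr_gt0.
case=> e /= e0 He.
suff : h (a + e / 2) < h a by rewrite ltNge hmin.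
have dneg : {in `]a, a + e / 2[, forall x, derive1 h x < 0}.
  move=> x; rewrite in_itv /= => /andP[ax xe]; rewrite -(subrK a x).
  by apply: He; rewrite /= ?sub0r ?normrN ?gtr0_norm; lra.
have hcont : {within `[a, a + e / 2], continuous h}.
  by apply: derivable_within_continuous => x _; exact: hd.
have hdoo : {in `]a, a + e / 2[, forall x, derivable h x 1}.
  by move=> x _; exact: hd.
by apply: (ltr0_derive1_lt_cc hdoo dneg hcont); rewrite ?in_itv/=; lra.
Unshelve. all: by end_near. Qed.

(** * The first touching time *)

(** By periodicity the nonpositive set of [w] can be cut down to a compact part of [[0, 1] *
    [0, T]], on which the time coordinate attains its minimum [t0]. *)
Lemma first_touching (R : realType) (w : R -> R -> R) (T x1 : R) :
  0 <= T ->
  (forall t, 0 <= t <= T -> periodic (w ^~ t) 1) ->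
  {within [set p : R * R | 0 <= p.2 <= T],
    continuous (fun p : R * R => w p.1 p.2)} ->
  (forall x, 0 < w x 0) ->
  w x1 T <= 0 ->
  exists x0 t0, [/\ x0 \in `[0, 1], 0 < t0 <= T, w x0 t0 = 0, forall x, 0 <= w x t0
    & forall x s, 0 <= s < t0 -> 0 < w x s].
Proof.
move=> T0 wper wcont w0 w1.
set A := [set p : R * R | 0 <= p.2 <= T].
(* Continuity on the strip makes the nonpositive set only relatively closed; [V] is a closed set of
   the plane with the same trace. *)
have [V Vcl VE] : exists2 V : set (R * R), closed V &
    V `&` A = [set p | w p.1 p.2 <= 0] `&` A.
  by apply/closed_subspaceP; move/continuous_closedP : wcont => /(_ _ (@closed_le _ 0)).
have VP x t : 0 <= t <= T -> w x t <= 0 -> V (x, t).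
  by move=> tT wx; have [] : (V `&` A) (x, t) by rewrite VE.
have PV x t : 0 <= t <= T -> V (x, t) -> w x t <= 0.
  by move=> tT wx; have [] : ([set p | w p.1 p.2 <= 0] `&` A) (x, t) by rewrite -VE.
set Z := `[0, 1]%classic `*` `[0, T]%classic `&` V.
have Zc : compact Z.
  by apply: compact_closedI => //; apply: compact_setX; exact: segment_compact.
have perR x t : 0 <= t <= T -> exists2 y, y \in `[0, 1] & w x t = w y t.
  by move=> tT; exact: (periodic_unit_repr _ (wper t tT)).
have ZP x t : 0 <= t <= T -> w x t <= 0 -> exists y, Z (y, t).
  move=> tT; have [y y01 ->] := perR x t tT => wy; exists y.
  by split; [split => //=; rewrite in_itv | exact: VP].
have TT : 0 <= T <= T by rewrite T0 lexx.
have Z0 : Z !=set0 by have [y Zy] := ZP _ _ TT w1; exists (y, T).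
have [|[x0 t0] + tmin] := compact_EVT_min (f := snd) Z0 Zc.
  by apply: continuous_subspaceT => p; exact: cvg_snd.
rewrite inE => -[[/= x001]]; rewrite in_itv /= => t0T /(PV _ _ t0T) wx0.
have t0gt0 : 0 < t0.
  rewrite lt_neqAle (andP t0T).1 andbT; apply/eqP => t00.
  by move: wx0; rewrite -t00 leNgt w0.
have before x s : 0 <= s < t0 -> 0 < w x s.
  move=> /andP[s0 st]; rewrite ltNge; apply/negP => ws.
  have [|y Zy] := ZP x s _ ws; first by rewrite s0 (le_trans (ltW st))// (andP t0T).2.
  by have := tmin (y, s); rewrite inE => /(_ Zy) /=; rewrite leNgt st.
(* A negative value at [t0] would persist at slightly earlier times, against [before]; the maximum
   with 0 keeps [s] in the strip. *)
have at0 x : 0 <= w x t0.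
  rewrite leNgt; apply/negP => wneg.
  move/subspace_continuousP : wcont => /(_ (x, t0) t0T) /cvgr_lt /(_ _ wneg).
  rewrite near_withinE => /nbhs_ballP[e /= e0 He].
  pose s := Num.max 0 (t0 - e / 2).
  have s0 : 0 <= s by rewrite le_max lexx.
  have st : s < t0 by rewrite gt_max t0gt0 /=; lra.
  have es : t0 - e / 2 <= s by rewrite le_max lexx orbT.
  have := He (x, s); rewrite /= => /(_ _ _) H.
  have := before x s; rewrite s0 st => /(_ isT); rewrite ltNge => /negP; apply; apply/ltW/H.
    split => /=; first exact: ballxx.
    rewrite -ball_normE /= ger0_norm; lra.
  by rewrite s0 /=; move/andP : t0T => []; lra.
exists x0, t0; split => //;
  first by rewrite t0gt0; case/andP: t0T.
by apply/eqP; rewrite eq_le wx0 at0.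
Qed.

(** * Comparison with the two barriers *)

Lemma derivable_mulrl (R : realType) (k : R) (h : R -> R) (x : R) :
  derivable h x 1 -> derivable (fun z => k * h z) x 1.
Proof. exact: (@derivableZ _ _ _ h k x 1). Qed.

Lemma derive1B (R : realType) (h k : R -> R) (x : R) :
  derivable h x 1 -> derivable k x 1 ->
  derive1 (fun z => h z - k z) x = derive1 h x - derive1 k x.
Proof. by move=> hd kd; rewrite derive1E (deriveB hd kd) !derive1E. Qed.

Lemma closed_timeW (R : realType) (S : \bar R) (T t : R) :
  closed_time S T -> 0 <= t <= T -> closed_time S t.
Proof.
move=> [_ TS] /andP[t0 tT]; split=> //.
by apply: le_lt_trans TS; rewrite lee_fin.
Qed.

(* [K] bounds [g''] from below; the smallness condition is the
   subsolution inequality for [lam * eps * g], multiplied by [lam * eps * g]. *)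
Lemma solution_gt_subsolution (R : realType) (n : nat) (f g : R -> R)
    (eps lam K : R) (S : \bar R) (u : R -> R -> R) :
  0 < eps -> 0 < lam < 1 -> 0 <= K ->
  torus_Ck 2 g -> (forall x, 0 < g x) -> (forall x, 0 < f x) ->
  (forall x, x \in `[0, 1] -> - K <= derive1 (derive1 g) x) ->
  (forall x, lam ^+ 2 * eps ^+ 2 * K * g x + (n%:R - 1) < lam * (f x * g x)) ->
  classical_solution n f g eps S u ->
  forall x t, closed_time S t -> lam * eps * g x < u x t.
Proof.
move=> eps0 /andP[lam0 lam1] K0 [gper gd gc] g0 f0 gK hsub hu x T cT.
have {}gd1 y : derivable g y 1 by exact: (gd 0%N).
have {}gd2 y : derivable (derive1 g) y 1 by exact: (gd 1%N).
rewrite ltNge; apply/negP => uT.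
pose w y t := u y t - lam * eps * g y.
have [|||||y [t [y01 /andP[t0 tT] wyt wmin wbef]]] := @first_touching R w T x.
- exact: cT.1.
- move=> t tT y; rewrite /w gper; congr (_ - _).
  exact: (sol_periodic hu (closed_timeW cT tT)).
- have uc := continuous_subspaceW (B := [set p | closed_time S p.2])
    (fun p => @closed_timeW R S T p.2 cT) (sol_continuous hu).
  move=> p; apply: cvgB; first exact: uc.
  apply: (@continuous_subspaceT _ _ _ (fun p : R * R => lam * eps * g p.1)) => {}p.
  apply: cvgM; first exact: cvg_cst.
  apply: (@continuous_comp _ _ _ fst g); first exact: cvg_fst.
  by apply: differentiable_continuous; exact/derivable1_diffP.
- by move=> y; rewrite /w (sol_initial hu) subr_gt0 -mulrA gtr_pMl// mulr_gt0.
- by rewrite /w subr_le0.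
have oT : open_time S t.
  by split=> //; apply: (closed_timeW cT _).2; rewrite ltW.
have ud1 z : derivable (u ^~ t) z 1 by exact: (sol_derivable_x hu).
have ud2 : derivable (derive1 (u ^~ t)) y 1 by exact: (sol_derivable_xx hu).
have ld1 z : derivable (fun z => lam * eps * g z) z 1.
  exact: (derivable_mulrl (gd1 z)).
have dwE z : derive1 (w ^~ t) z = derive1 (u ^~ t) z - lam * eps * derive1 g z.
  by rewrite (derive1B (ud1 z) (ld1 z)) (derive1Ml _ (gd1 z)).
have wd1 z : derivable (w ^~ t) z 1 by exact: (derivableB (ud1 z) (ld1 z)).
have wmin' z : w y t <= w z t by rewrite wyt.
have dw2 : derive1 (w ^~ t) = derive1 (u ^~ t) - (fun z => lam * eps * derive1 g z).
  by apply/funext => z; rewrite dwE.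
have ld2 : derivable (fun z => lam * eps * derive1 g z) y 1.
  exact: (derivable_mulrl (gd2 y)).
have wd2 : derivable (derive1 (w ^~ t)) y 1.
  by rewrite dw2; exact: (derivableB ud2 ld2).
have := derive1_second_min wd1 wd2 wmin'.
rewrite dw2 (derive1B ud2 ld2) (derive1Ml _ (gd2 y)) subr_ge0 => uxx.
have utd : derivable (u y) t 1 by exact: (sol_derivable_t hu).
have cd : derivable (cst (lam * eps * g y)) t 1 by exact: derivable_cst.
(* The barrier is stationary, so [w] and [u] have the same time derivative. *)
have ut : dt u y t <= 0.
  have -> : dt u y t = derive1 (w y) t.
    by rewrite (derive1B utd cd) derive1_cst subr0.
  apply: (@derive1_left_min _ (w y) _ 0 (derivableB utd cd) t0).
  by move=> s /andP[s0 st]; rewrite wyt ltW// wbef// ltW.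
move: ut; rewrite (sol_equation hu y oT) leNgt => /negP; apply.
set q := dx u y t ^+ 2 + 1.
have q1 : 1 <= q by rewrite lerDr sqr_ge0.
have q0 : 0 < q := lt_le_trans ltr01 q1.
have sq1 : 1 <= Num.sqrt q by rewrite -[leLHS]sqrtr1 ler_wsqrtr.
have uE : u y t = lam * eps * g y := subr0_eq wyt.
have gy := g0 y.
have c0 : 0 < lam * eps * g y by rewrite mulr_gt0 ?mulr_gt0.
(* Dividing by [q >= 1] preserves a nonpositive lower bound, and in [H2] the factor
   [Num.sqrt q >= 1] only helps; the size of the gradient thus drops out. *)
have H1 : - (lam * eps * K) <= dxx u y t / q.
  rewrite ler_pdivlMr//.
  apply: (@le_trans _ _ (lam * eps * - K)); first by rewrite mulrN mulNr lerN2 ler_peMr// !mulr_ge0// ltW.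
  by apply: le_trans uxx; rewrite ler_pM2l ?mulr_gt0// gK.
have H2 : eps^-1 * f y <= eps^-1 * f y * Num.sqrt q.
  by rewrite ler_peMr// mulr_ge0 ?invr_ge0 ?(ltW eps0) ?(ltW (f0 y)).
have H3 : 0 < - (lam * eps * K) - (n%:R - 1) / u y t + eps^-1 * f y.
  have -> : - (lam * eps * K) - (n%:R - 1) / u y t + eps^-1 * f y =
     (lam * (f y * g y) - (lam ^+ 2 * eps ^+ 2 * K * g y + (n%:R - 1))) / (lam * eps * g y).
    by rewrite uE; field; rewrite !gt_eqF.
  by rewrite divr_gt0// subr_gt0.
apply: lt_le_trans H3 _; exact: lerD (lerD H1 (lexx _)) H2.
Qed.

(** At a first contact from below with the flat barrier, [u_x = 0] and [u_xx <= 0], so the reaction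
    terms force [u_t <= - 2 c], whereas touching requires [u_t >= - c]. *)
Lemma lifetime_le_supersolution (R : realType) (n : nat) (f g : R -> R)
    (eps F G : R) (S : \bar R) (u : R -> R -> R) :
  0 < eps -> (forall x, 0 < f x) -> (forall x, 0 < g x) ->
  (forall x, f x <= F) -> (forall x, g x <= G) ->
  F * G < n%:R - 1 ->
  classical_solution n f g eps S u ->
  exists T : R, (S <= T%:E)%E.
Proof.
move=> eps0 f0 g0 fF gG FG hu.
have F0 : 0 < F := lt_le_trans (f0 0) (fF 0).
have G0 : 0 < G := lt_le_trans (g0 0) (gG 0).
(* [H] is the midpoint of [G] and [(n - 1) / F]. *)
have [H GH FH] : exists2 H, G < H & F * H < n%:R - 1.
  exists ((G + (n%:R - 1) / F) / 2); rewrite ?midf_lt// ?ltr_pdivlMr// 1?mulrC//.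
  have -> : (G + (n%:R - 1) / F) / 2 * F = (F * G + (n%:R - 1)) / 2.
    by field; rewrite gt_eqF.
  by lra.
have H0 : 0 < H := lt_trans G0 GH.
(* Half the decay rate that the reaction terms, with [f] replaced by [F], give at height [eps * H];
   [T] is when the barrier vanishes. *)
pose c := ((n%:R - 1) / H - F) / (2 * eps).
have c0 : 0 < c by rewrite divr_gt0 ?mulr_gt0// subr_gt0 ltr_pdivlMr.
pose T := eps * H / c.
have T0 : 0 < T by rewrite !mulr_gt0// invr_gt0.
exists T; rewrite leNgt; apply/negP => TS.
have cT : closed_time S T by split => //; exact: ltW.
pose w y t := eps * H - c * t - u y t.
have [|||||y [t [y01 /andP[t0 tT] wyt wmin wbef]]] := @first_touching R w T 0.
- exact: cT.1.
- move=> t tT y; rewrite /w; congr (_ - _).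
  exact: (sol_periodic hu (closed_timeW cT tT)).
- have uc := continuous_subspaceW (B := [set p | closed_time S p.2])
    (fun p => @closed_timeW R S T p.2 cT) (sol_continuous hu).
  move=> p; apply: cvgB; last exact: uc.
  apply: (@continuous_subspaceT _ _ _ (fun p : R * R => eps * H - c * p.2)) => {}p.
  apply: cvgB; first exact: cvg_cst.
  by apply: cvgM; [exact: cvg_cst|exact: cvg_snd].
- move=> y; rewrite /w (sol_initial hu) mulr0 subr0 subr_gt0 ltr_pM2l//.
  exact: le_lt_trans GH.
- rewrite /w /T mulrCA divff ?gt_eqF// mulr1 subrr sub0r oppr_le0.
  exact/ltW/(sol_positive hu).
have oT : open_time S t.
  by split=> //; apply: (closed_timeW cT _).2; rewrite ltW.
have ld1 (z : R) : derivable (cst (eps * H - c * t) : R -> R) z 1 by exact: derivable_cst.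
have ud1 z : derivable (u ^~ t) z 1 by exact: (sol_derivable_x hu).
have ud2 : derivable (derive1 (u ^~ t)) y 1 by exact: (sol_derivable_xx hu).
have dwE : derive1 (w ^~ t) = - derive1 (u ^~ t).
  by apply/funext => z; rewrite (derive1B (ld1 z) (ud1 z)) derive1_cst sub0r.
have wd1 z : derivable (w ^~ t) z 1 by exact: (derivableB (ld1 z) (ud1 z)).
have wmin' z : w y t <= w z t by rewrite wyt.
have wd2 : derivable (derive1 (w ^~ t)) y 1 by rewrite dwE; exact: (derivableN ud2).
have ux0 : dx u y t = 0.
  have := derive1_global_min wd1 wmin'; rewrite dwE => /eqP.
  by rewrite oppr_eq0 => /eqP.
have uxx : dxx u y t <= 0.
  have := derive1_second_min wd1 wd2 wmin'.
  by rewrite dwE derive1E (deriveN ud2) oppr_ge0 -derive1E.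
have utd : derivable (u y) t 1 by exact: (sol_derivable_t hu).
have cd : derivable (cst (eps * H) : R -> R) t 1 by exact: derivable_cst.
have idd : derivable (id : R -> R) t 1 by exact: derivable_id.
have ld : derivable (fun s => c * id s) t 1 by exact: (derivable_mulrl idd).
have bd : derivable (fun s => eps * H - c * s) t 1 by exact: (derivableB cd ld).
have bE : derive1 (fun s => eps * H - c * s) t = - c.
  rewrite (derive1B cd ld) derive1_cst sub0r.
  by rewrite (derive1Ml _ idd) derive1_id mulr1.
have ut : - c <= dt u y t.
  have : derive1 (w y) t <= 0.
    apply: (@derive1_left_min _ (w y) _ 0 (derivableB bd utd) t0).
    by move=> s /andP[s0 st]; rewrite wyt ltW// wbef// ltW.
  by rewrite (derive1B bd utd) bE subr_le0.
move: ut; rewrite (sol_equation hu y oT) ux0 expr0n add0r sqrtr1 divr1 mulr1.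
have up : 0 < u y t by apply: (sol_positive hu); apply: (closed_timeW cT); rewrite (ltW t0).
(* The barrier has only descended from [eps * H], so the singular term is at least as strong as at
   the initial height. *)
have uH : u y t <= eps * H.
  rewrite -(subr0_eq wyt : eps * H - c * t = u y t) lerBlDr lerDl.
  by rewrite mulr_ge0 ?(ltW c0) ?(ltW t0).
have n1 : 0 < n%:R - 1 :> R := lt_trans (mulr_gt0 F0 H0) FH.
have reac : (n%:R - 1) / (eps * H) <= (n%:R - 1) / u y t.
  by rewrite ler_pM2l// lef_pV2 ?posrE ?mulr_gt0.
have forc : eps^-1 * f y <= eps^-1 * F by rewrite ler_pM2l ?invr_gt0.
have cE : - (n%:R - 1) / (eps * H) + eps^-1 * F = - 2 * c.
  by rewrite /c; field; rewrite !gt_eqF.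
move: uxx c0 reac forc cE; clear; lra.
Qed.

(** * Choice of constants and conclusion on quenching times *)

Theorem theorem1p1 (R : realType) (n : nat) (hn : (1 <= n)%N)
    (f g : R -> R)
    (hf : torus_Ck 1 f) (hf0 : forall x, 0 < f x)
    (hg : torus_Ck 2 g) (hg0 : forall x, 0 < g x)
    (u : R -> R -> R -> R) (S : R -> \bar R)
    (hu : forall eps, 0 < eps -> maximal_solution n f g eps (S eps) (u eps)) :
  (n%:R - 1 < torus_min (fun x => f x * g x) ->
    exists eps0 c0 : R, [/\ 0 < eps0, 0 < c0 &
      forall eps, 0 < eps -> eps < eps0 ->
        quenching_time (S eps) (u eps) = +oo%E /\
        (forall x t, 0 <= t -> eps * c0 <= u eps x t)]) /\
  (torus_max f * torus_max g < n%:R - 1 ->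
    forall eps, 0 < eps -> (quenching_time (S eps) (u eps) < +oo)%E).
Proof.
have [fper fd _] := hf; have [gper gd gc2] := hg.
have fc : continuous f.
  by move=> x; apply/differentiable_continuous/derivable1_diffP; exact: (fd 0%N).
have gc : continuous g.
  by move=> x; apply/differentiable_continuous/derivable1_diffP; exact: (gd 0%N).
have fM := periodic_le_torus_max fper fc.
have gM := periodic_le_torus_max gper gc.
split; last first.
  move=> fgn eps eps0; have [_ husol _] := hu eps eps0.
  have [T ST] := lifetime_le_supersolution eps0 hf0 hg0 fM gM fgn husol.
  apply: (@le_lt_trans _ _ T%:E); last exact: ltry.
  apply: ge_ereal_sup => _ [t [[_ tS] _] <-].
  exact: le_trans (ltW tS) ST.
set m := torus_min _ => nm.
have n0 : 0 <= n%:R - 1 :> R by rewrite subr_ge0 ler1n.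
have m0 : 0 < m by exact: le_lt_trans nm.
have mfg x : m <= f x * g x.
  by apply: (@torus_min_le _ (fun x => f x * g x)) => y; exact: mulr_gt0.
have [cg cg0 cgg] := periodic_pos_lb gper gc hg0.
(* One period suffices, as touching points are found in [[0, 1]]; the absolute value makes [K]
   nonnegative. *)
have [K K0 gK] : exists2 K, 0 <= K &
    forall x, x \in `[0, 1] -> - K <= derive1 (derive1 g) x.
  have [y _ yP] := EVT_min (@ler01 R) (continuous_subspaceT gc2).
  exists `|derive1n 2 g y|; first exact: normr_ge0.
  move=> x x01; apply: le_trans (yP x x01).
  by rewrite lerNl -normrN ler_norm.
have [lam /andP[lam0 lam1] nlam] :
    exists2 lam, 0 < lam < 1 & n%:R - 1 < lam * m.
  (* The midpoint of [(n - 1) / m] and 1. *)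
  exists (((n%:R - 1) / m + 1) / 2).
    have : 0 <= (n%:R - 1) / m by rewrite divr_ge0// ltW.
    have : (n%:R - 1) / m < 1 by rewrite ltr_pdivrMr// mul1r.
    by move=> *; apply/andP; split; lra.
  have -> : ((n%:R - 1) / m + 1) / 2 * m = (n%:R - 1 + m) / 2.
    by field; rewrite gt_eqF.
  lra.
have G0 : 0 < torus_max g := lt_le_trans (hg0 0) (gM 0).
set G := torus_max g in gM G0 *.
have KG0 : 0 < K * G + 1 by rewrite ltr_wpDl// mulr_ge0// ltW.
(* For [eps < 1] the diffusion loss [lam^2 eps^2 K g] is at most [eps K G], which must stay below
   the margin [lam m - (n - 1)]; the [+ 1] keeps the denominator positive when [K = 0]. *)
exists (Num.min 1 ((lam * m - (n%:R - 1)) / (K * G + 1))), (lam * cg).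
split; [by rewrite lt_min ltr01 divr_gt0// subr_gt0|exact: mulr_gt0|].
move=> eps eps0; rewrite lt_min ltr_pdivlMr// => /andP[eps1 epsK].
have [S0 husol hmax] := hu eps eps0.
have sub x : lam ^+ 2 * eps ^+ 2 * K * g x + (n%:R - 1) < lam * (f x * g x).
  apply: (@lt_le_trans _ _ (lam * m)); last by rewrite ler_pM2l.
  rewrite -ltrBrDr; apply: le_lt_trans epsK.
  apply: (@le_trans _ _ (eps * (K * G))); last by rewrite ler_pM2l// lerDl.
  have lam2 : lam ^+ 2 <= 1 by rewrite expr_le1 ?(ltW lam1) ?(ltW lam0).
  have eps2 : eps ^+ 2 <= eps by rewrite expr2 ler_piMr ?(ltW eps0) ?(ltW eps1).
  have le2 : lam ^+ 2 * eps ^+ 2 <= eps.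
    by apply: le_trans eps2; rewrite ler_piMl ?sqr_ge0.
  rewrite -mulrA; apply: ler_pM => //.
  - by rewrite mulr_ge0 ?sqr_ge0.
  - by rewrite mulr_ge0 ?(ltW (hg0 x)).
  - exact: ler_wpM2l.
have lam01 : 0 < lam < 1 by rewrite lam0.
have lb := solution_gt_subsolution eps0 lam01 K0 hg hg0 hf0 gK sub husol.
have lbc x t : closed_time (S eps) t -> eps * (lam * cg) <= u eps x t.
  move=> ct; apply: le_trans (ltW (lb x t ct)).
  by rewrite mulrA [eps * lam]mulrC ler_pM2l// mulr_gt0.
have clb0 : 0 < eps * (lam * cg) by rewrite !mulr_gt0.
(* A finite lifetime would make the infimum of the solution 0 by maximality, against the uniform
   bound [lbc]. *)
have SE : S eps = +oo%E.
  apply/eqP; rewrite eq_le leey leNgt; apply/negP => /hmax inf0.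
  have : eps * (lam * cg) <= inf [set y | exists x t, closed_time (S eps) t /\ y = u eps x t].
    apply: lb_le_inf; first by exists (u eps 0 0), 0, 0; split.
    by move=> _ [x [t [ct ->]]]; exact: lbc.
  by rewrite inf0 leNgt clb0.
split; last by move=> x t t0; apply: lbc; split => //; rewrite SE ltry.
(* The maximum with 1 gives a positive time beyond [r], hence one admissible in the supremum. *)
apply: eq_infty => r; apply: (@le_trans _ _ (Num.max r 1)%:E).
  by rewrite lee_fin le_max lexx.
have max0 : 0 < Num.max r 1 by rewrite lt_max ltr01 orbT.
apply: ereal_sup_ubound; exists (Num.max r 1) => //; split.
  by split => //; rewrite SE ltry.
apply: lt_le_trans clb0 _; apply: lb_le_inf; first by exists (u eps 0 (Num.max r 1)), 0.
by move=> _ [x _ <-]; apply: lbc; split; [exact: ltW|rewrite SE ltry].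
Qed.
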